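(* Let $G$ be a group with presentation $$G=\langle s_1,\dots,s_\ell,d_1,\dots,d_q\mid s_1^{\gamma_1},\dots,s_\ell^{\gamma_\ell},\ s_1\cdots s_\ell W\rangle,$$ where all $\gamma_i\ge2$, $\ell\geq 3$, and $W$ is an arbitrary element of the free group $F(d_1,\dots,d_q)$. Assume that the quotient group $$G_0=G/\langle\langle d_1,\dots,d_q\rangle\rangle=\langle s_1,\dots,s_\ell\mid s_1^{\gamma_1},\dots,s_\ell^{\gamma_\ell},\ s_1\cdots s_\ell\rangle$$ is non-exceptional. Let $\mathcal U=(s_i^{u_i})_{i\ne j}$ and $\mathcal V=(s_i^{v_i})_{i\ne k}$, for some $j,k\in\{1,\dots,\ell\}$, be standard generating systems of $G_0$, define $u_j=v_k=1$, and consider the generating systems $$\mathcal U^*=\mathcal U\cup\{d_1,\dots,d_q\},\qquad \mathcal V^*=\mathcal V\cup\{d_1,\dots,d_q\}$$ of $G$ (where $s_i^{u_i}$, $s_i^{v_i}$ are now read as elements of $G$). Then $\mathcal U^*$ and $\mathcal V^*$ are Nielsen equivalent if and only if $u_i\equiv\pm v_i\pmod{\gamma_i}$ for all $i=1,\dots,\ell$ (where the sign may depend on $i$).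
   Context: Standard generating system of $G_0$: a family $(s_i^{u_i})_{i\in\{1,\dots,\ell\}\setminus\{j\}}$ with integers $u_i$ satisfying $\gcd(u_i,\gamma_i)=1$ for all $i\neq j$. Nielsen equivalence: for an $N$-tuple $(x_1,\dots,x_N)$ of elements of a group, an elementary Nielsen operation is one of: (1) a permutation of the $x_i$; (2) replacing some $x_i$ by $x_ix_j$ or by $x_jx_i$ with $j\ne i$, leaving the other entries unchanged; (3) replacing some $x_i$ by $x_i^{-1}$, leaving the other entries unchanged. Two tuples are Nielsen equivalent if one is obtained from the other by a finite sequence of elementary Nielsen operations. Exceptional groups: let $G_0=\langle s_1,\dots,s_\ell\mid s_1^{\gamma_1},\dots,s_\ell^{\gamma_\ell},s_1\cdots s_\ell\rangle$ with all $\gamma_i\ge2$. Let $m$ be the number of exponents $\gamma_i\ge3$ and $n$ the number of exponents equal to $2$. Rearranging the exponents in non-increasing order $\gamma^{(1)}\ge\gamma^{(2)}\ge\dots$, we say $G_0$ is of type $(\gamma^{(1)},\dots,\gamma^{(m)}\mid n)$. For an odd integer $k$ the symbol $k^*$ stands for either $k$ or $2k$ (and is undefined for even $k$, so its use implies that $k$ is odd). Then $G_0$ is exceptional if one of the following holds: (a) $m\le3$; (b) $n$ is even and $G_0$ is of type $(\gamma,6,5,4\mid n)$ or $(\gamma,5,4,3\mid n)$ for some $\gamma$; (c) $n$ is even and $G_0$ is of type $(\gamma,\gamma',4,4\mid n)$ for some $\gamma,\gamma'$; (d) $n$ is odd and $m=4$; (e) $n$ is odd and $G_0$ is of type $(s^*,t^*,p^*,q^*,3^*\mid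 n)$ for some odd $s,t$ and some $p,q\in\{3,5\}$; (f) $n$ is odd and $G_0$ is of type $(p^*,q^*,3^*,3^*,3^*,3^*\mid n)$ for some odd $p$ and some $q\in\{3,5\}$. Otherwise $G_0$ is non-exceptional. *)

(* Defs.v *)
From mathcomp Require Import all_boot all_order all_fingroup all_algebra.
From Stdlib Require Import Relation_Operators.

Set Implicit Arguments.
Unset Strict Implicit.
Unset Printing Implicit Defensive.

Local Open Scope group_scope.

(* A word over the alphabet X; the letter (x, false) stands for x and the
   letter (x, true) for x^-1.  Every element of the free group F(X) is
   represented by such a word, not necessarily reduced. *)
Definition word (X : Type) := seq (X * bool).

(* w1 and w2 have the same image in the group < X | rels >. *)
Inductive presented_eq (X : Type) (rels : word X -> Prop) :
    word X -> word X -> Prop :=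
| PresRefl w : presented_eq rels w w
| PresSym w1 w2 : presented_eq rels w1 w2 -> presented_eq rels w2 w1
| PresTrans w1 w2 w3 :
    presented_eq rels w1 w2 -> presented_eq rels w2 w3 ->
    presented_eq rels w1 w3
| PresCat w1 w2 w1' w2' :
    presented_eq rels w1 w1' -> presented_eq rels w2 w2' ->
    presented_eq rels (w1 ++ w2) (w1' ++ w2')
| PresCancel x b : presented_eq rels [:: (x, b); (x, ~~ b)] [::]
| PresRel r : rels r -> presented_eq rels r [::].

Definition eval_word (X : Type) (G : groupType) (g : X -> G) (w : word X) : G :=
  \prod_(a <- w) (if a.2 then (g a.1)^-1 else g a.1).

(* The homomorphism F(X) -> G extending g induces an isomorphism from
   < X | rels > onto G. *)
Definition has_presentation (X : Type) (G : groupType) (g : X -> G)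
    (rels : word X -> Prop) : Prop :=
  (forall a : G, exists w : word X, eval_word g w = a) /\
  (forall w1 w2 : word X,
      eval_word g w1 = eval_word g w2 <-> presented_eq rels w1 w2).

(* The relators s_1^gamma_1, ..., s_l^gamma_l and s_1 ... s_l W on the
   generators s_i = inl i and d_k = inr k. *)
Inductive fuchsian_relator (l q : nat) (gamma : 'I_l -> nat) (W : word 'I_q) :
    word ('I_l + 'I_q)%type -> Prop :=
| PowerRelator (i : 'I_l) :
    fuchsian_relator gamma W (nseq (gamma i) (inl i, false))
| LongRelator :
    fuchsian_relator gamma W
      ([seq (inl i, false) | i <- enum 'I_l] ++ [seq (inr a.1, a.2) | a <- W]).

Definition fuchsian_generators (l q : nat) (G : groupType) (s : 'I_l -> G)
    (d : 'I_q -> G) (x : 'I_l + 'I_q) : G :=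
  match x with inl i => s i | inr k => d k end.

Definition expgz (G : groupType) (x : G) (z : int) : G :=
  match z with Posz n => x ^+ n | Negz n => x ^- n.+1 end.

Inductive nielsen_op (N : nat) (G : groupType) (x : N.-tuple G) :
    N.-tuple G -> Prop :=
| NielsenPerm (p : 'S_N) :
    nielsen_op x [tuple tnth x (p a) | a < N]
| NielsenMulr (i j : 'I_N) : j != i ->
    nielsen_op x
      [tuple if a == i then tnth x i * tnth x j else tnth x a | a < N]
| NielsenMull (i j : 'I_N) : j != i ->
    nielsen_op x
      [tuple if a == i then tnth x j * tnth x i else tnth x a | a < N]
| NielsenInv (i : 'I_N) :
    nielsen_op x
      [tuple if a == i then (tnth x i)^-1 else tnth x a | a < N].

Definition nielsen_equiv (N : nat) (G : groupType) :
    N.-tuple G -> N.-tuple G -> Prop :=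
  clos_refl_trans (N.-tuple G) (@nielsen_op N G).

(* G_0 denotes < s_1, ..., s_l | s_i^(gamma_i), s_1 ... s_l >.  Its standard
   generating systems are the families (s_i^(u_i))_(i != j) whose exponents
   satisfy this condition; the value u j is not part of the data. *)
Definition standard_exponents (l : nat) (gamma : 'I_l -> nat) (j : 'I_l)
    (u : 'I_l -> int) : Prop :=
  forall i : 'I_l, i != j -> coprimez (u i) (gamma i)%:Z.

(* The tuple (s_i^(u_i))_(i != j), d_1, ..., d_q in G; lift j enumerates the
   indices different from j in increasing order. *)
Definition extended_system (l q : nat) (G : groupType) (s : 'I_l -> G)
    (d : 'I_q -> G) (j : 'I_l) (u : 'I_l -> int) : (l.-1 + q).-tuple G :=
  [tuple match split a with
         | inl i => expgz (s (lift j i)) (u (lift j i))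
         | inr k => d k
         end | a < l.-1 + q].

(* G_0 has type (gamma^(1), ..., gamma^(m) | n), where the gamma^(i) are the
   entries of big_exponents gamma (the exponents >= 3, in non-increasing order)
   and n = num_two gamma. *)
Definition big_exponents (l : nat) (gamma : 'I_l -> nat) : seq nat :=
  sort geq [seq gamma i | i <- enum 'I_l & 3 <= gamma i].

Definition num_two (l : nat) (gamma : 'I_l -> nat) : nat :=
  #|[set i : 'I_l | gamma i == 2]|.

(* g is a value of the symbol k^*, which stands for k or 2k and is undefined
   for even k. *)
Definition star (k g : nat) : Prop := odd k /\ (g = k \/ g = 2 * k)%N.

Definition three_or_five (k : nat) : Prop := k = 3 \/ k = 5.

Inductive exceptional (l : nat) (gamma : 'I_l -> nat) : Prop :=
| ExcA : size (big_exponents gamma) <= 3 -> exceptional gamma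
| ExcB g : ~~ odd (num_two gamma) ->
    big_exponents gamma = [:: g; 6; 5; 4] \/
    big_exponents gamma = [:: g; 5; 4; 3] -> exceptional gamma
| ExcC g g' : ~~ odd (num_two gamma) ->
    big_exponents gamma = [:: g; g'; 4; 4] -> exceptional gamma
| ExcD : odd (num_two gamma) -> size (big_exponents gamma) = 4 ->
    exceptional gamma
| ExcE s t p q gs gt gp gq g3 : odd (num_two gamma) ->
    three_or_five p -> three_or_five q ->
    star s gs -> star t gt -> star p gp -> star q gq -> star 3 g3 ->
    big_exponents gamma = [:: gs; gt; gp; gq; g3] -> exceptional gamma
| ExcF p q gp gq g1 g2 g3 g4 : odd (num_two gamma) ->
    three_or_five q ->
    star p gp -> star q gq ->
    star 3 g1 -> star 3 g2 -> star 3 g3 -> star 3 g4 ->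
    big_exponents gamma = [:: gp; gq; g1; g2; g3; g4] -> exceptional gamma.

Definition eqmod_sign (m : nat) (a b : int) : Prop :=
  (a = b %[mod m%:Z])%Z \/ (a = (- b)%R %[mod m%:Z])%Z.

(* Main.v *)
Require Import Defs.
From mathcomp Require Import all_boot all_order all_fingroup all_algebra.
From mathcomp Require Import all_solvable all_field ring.
From Stdlib Require Import Relation_Operators.

Set Implicit Arguments.
Unset Strict Implicit.
Unset Printing Implicit Defensive.
Import GroupScope Order.TTheory GRing.Theory Num.Theory.

(** Sufficiency.  Since [u k] is congruent to 1 or -1, the first system contains
    [s k] up to inversion.  The long relation writes [s j] as a product in which
    [s k] occurs exactly once and whose other factors lie in the subgroup
    generated by the other entries, so Nielsen operations replace [s k] by [s j]
    ([exchange_generator]); inversions and a permutation do the rest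
    ([nielsen_equiv_extended]).

    Necessity.  Let [rho] be a homomorphism from [G] to 2 x 2 matrices of
    determinant 1, and let [Delta] be a crossed homomorphism over [rho], that is
    [Delta (a * b) = Delta a + rho a *m Delta b].  Stack the matrices
    [Delta (x a)], for [a] running over a tuple [x] of length N, into one matrix
    with 2N rows.  An elementary Nielsen operation multiplies this stack on the
    left by a matrix of determinant 1, so if [Delta] takes values in matrices
    with 2N columns then the determinant of the stack is a Nielsen invariant
    ([nielsen_det_stack]).  This is Reidemeister torsion computed by Fox
    calculus, with crossed homomorphisms taking the place of derivatives.

    Let [rho (s i) = A i] with eigenvalues [lam i] and [(lam i)^-1], where
    [lam i] is a primitive root of unity of order [gamma i], and let [rho] be
    trivial on the [d m].  Because 1 is not an eigenvalue of [A i], the sum of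
    the powers [A i ^+ t] for [t < gamma i] is zero, and therefore the power
    relators put no constraint on [Delta]: its values on the generators other
    than [s j] are arbitrary, and the long relator determines [Delta (s j)]
    ([basis_crossed_hom_exists]).  Replacing a generator by its [n]-th power
    multiplies its block by the geometric sum of [n] powers of [A i], of
    determinant [chord_sq (lam i) n / chord_sq (lam i) 1], where
    [chord_sq z n = (1 - z ^+ n) * (1 - z ^- n)].  So Nielsen equivalence implies
    that the products over [i] of [chord_sq (lam i) (u i)] and of
    [chord_sq (lam i) (v i)] agree.

    Such matrices with [A 1 * ... * A l = 1] exist for every choice of primitive
    roots [lam i], provided that three of the [gamma i] are at least 3
    ([prod_mx22_eq1_exists]), which holds when the group is not exceptional.
    Varying [lam i0] alone among the primitive roots of order [gamma i0] isolates
    one index: the quotient of the two factors at [i0] is a positive constant,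
    and multiplicativity on the units modulo [gamma i0] forces that constant to
    be 1 ([eq_of_proportional]).  Equality of the two factors means that
    [u i0] and [v i0] agree up to sign modulo [gamma i0] ([chord_sq_inj]). *)

(** * Crossed homomorphisms on presented groups *)

Section CrossedHomomorphisms.
Local Open Scope ring_scope.

Variables (F : fieldType) (K : nat).

Definition crossed_hom (G : groupType) (rho : G -> 'M[F]_2)
    (Delta : G -> 'M[F]_(2, K)) : Prop :=
  [/\ rho 1%g = 1, {morph rho : a b / (a * b)%g >-> a * b}
    & forall a b, Delta (a * b)%g = Delta a + rho a *m Delta b].

Section Values.
Variables (G : groupType) (rho : G -> 'M[F]_2) (Delta : G -> 'M[F]_(2, K)).
Hypothesis hD : crossed_hom rho Delta.

Lemma crossed_hom1 : Delta 1%g = 0.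
Proof.
have [r1 _ dM] := hD; have := dM 1%g 1%g.
by rewrite mulg1 r1 mul1mx -{1}[Delta 1%g]addr0 => /addrI.
Qed.

Lemma crossed_homV a : Delta a^-1%g = - rho a^-1%g *m Delta a.
Proof.
have [_ _ dM] := hD; have := dM a^-1%g a.
by rewrite mulVg crossed_hom1 mulNmx => /eqP; rewrite eq_sym addr_eq0 => /eqP.
Qed.

Lemma crossed_homX a n :
  Delta (a ^+ n)%g = (\sum_(t < n) rho a ^+ t) *m Delta a.
Proof.
have [r1 rM dM] := hD.
have rX m : rho (a ^+ m)%g = rho a ^+ m.
  by elim: m => [|m IH]; rewrite ?expg0 // expgS rM IH exprS.
elim: n => [|n IH]; first by rewrite expg0 crossed_hom1 big_ord0 mul0mx.
by rewrite expgSr dM IH rX big_ord_recr mulmxDl.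
Qed.
End Values.

Section Words.
Variables (X : Type) (A : X -> 'M[F]_2).

Definition letter_mx (a : X * bool) : 'M[F]_2 :=
  if a.2 then (A a.1)^-1 else A a.1.

Definition word_mx (w : word X) : 'M[F]_2 := \prod_(a <- w) letter_mx a.

(** The value at [w] of the crossed homomorphism of the free group that takes
    [x] to [B x]: the sum over [x] of the Fox derivatives of [w] applied to
    [B x]. *)
Fixpoint fox (B : X -> 'M[F]_(2, K)) (w : word X) : 'M[F]_(2, K) :=
  if w is a :: w' then
    (if a.2 then - (letter_mx a *m B a.1) else B a.1)
      + letter_mx a *m fox B w'
  else 0.

Lemma word_mx_cat w1 w2 : word_mx (w1 ++ w2) = word_mx w1 * word_mx w2.
Proof. exact: big_cat. Qed.

Lemma fox_cat B w1 w2 : fox B (w1 ++ w2) = fox B w1 + word_mx w1 *m fox B w2.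
Proof.
elim: w1 => [|a w1 IH] /=; first by rewrite /word_mx big_nil mul1mx add0r.
by rewrite IH /word_mx big_cons mulmxDr addrA mulmxA.
Qed.

Lemma fox_nseq B x n :
  fox B (nseq n (x, false)) = (\sum_(t < n) A x ^+ t) *m B x.
Proof.
elim: n => [|n IH] /=; first by rewrite big_ord0 mul0mx.
rewrite IH big_ord_recl expr0 mulmxDl mul1mx /letter_mx /= mulmxA.
by congr (_ + _ *m _); rewrite mulmx_sumr; apply: eq_bigr => t _; rewrite exprS.
Qed.

(** A homomorphism together with a crossed homomorphism over it is a homomorphism
    to an affine group, so by von Dyck's principle only the relators have to be
    checked. *)
Lemma fox_presented_eq B rels w1 w2 :
    (forall x, A x \is a GRing.unit) ->
    (forall r, rels r -> word_mx r = 1 /\ fox B r = 0) ->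
  presented_eq rels w1 w2 ->
  word_mx w1 = word_mx w2 /\ fox B w1 = fox B w2.
Proof.
move=> Au hr; elim=> {w1 w2}.
- by [].
- by move=> w1 w2 _ [-> ->].
- by move=> w1 w2 w3 _ [-> ->] _ [-> ->].
- move=> w1 w2 w1' w2' _ [e1 f1] _ [e2 f2].
  by rewrite !fox_cat !word_mx_cat e1 e2 f1 f2.
- move=> x b; rewrite /word_mx !big_cons big_nil mulr1 /= mulmx0 addr0.
  case: b; rewrite /letter_mx /=; first by rewrite mulVr // addNr.
  by rewrite mulrV // mulmxN mulmxA -[_ *m _^-1]/(_ * _) mulrV // mul1mx addrN.
- by move=> r /hr [-> ->]; rewrite /word_mx big_nil.
Qed.

Lemma fox_eq (P : pred X) B B' w : (forall x, P x -> B x = B' x) ->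
  all (fun a => P a.1) w -> fox B w = fox B' w.
Proof.
by move=> eB; elim: w => [|a w IH] //= /andP[/eB -> /IH ->].
Qed.

End Words.

(** The equation is linear in the unknown value at [x0], with the coefficient
    [word_mx A w1], which is invertible. *)
Lemma fox_solve (X : eqType) (A : X -> 'M[F]_2) (B : X -> 'M[F]_(2, K))
    x0 (w1 w2 : word X) :
    (forall x, A x \is a GRing.unit) ->
    all (fun a => a.1 != x0) (w1 ++ w2) ->
  exists2 B' : X -> 'M[F]_(2, K), (forall x, x != x0 -> B' x = B x)
    & fox A B' (w1 ++ (x0, false) :: w2) = 0.
Proof.
move=> Au; rewrite all_cat => /andP[h1 h2].
have w1u : word_mx A w1 \is a GRing.unit.
  rewrite /word_mx; elim/big_ind: _ => [||[x b] _]; first exact: unitr1.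
    by move=> M N Mu Nu; rewrite -[_ \is a _]/(_ *m _ \in unitmx) unitmx_mul Mu.
  by rewrite /letter_mx /=; case: b; rewrite ?unitrV.
pose y := - ((word_mx A w1)^-1 *m fox A B w1 + A x0 *m fox A B w2).
exists (fun x => if x == x0 then y else B x) => [x /negPf -> //|].
set B' := (B' in fox A B' _).
have eB x : x != x0 -> B' x = B x by rewrite /B' => /negPf ->.
rewrite fox_cat /= (fox_eq _ eB h1) (fox_eq _ eB h2) /letter_mx /= /B' eqxx /y.
rewrite opprD -addrA addNr addr0 mulmxN mulmxA.
by rewrite -[_ *m _^-1]/(_ * _) mulrV // mul1mx addrN.
Qed.

Lemma crossed_hom_exists (X : choiceType) (G : groupType) (g : X -> G) rels
    (A : X -> 'M[F]_2) (B : X -> 'M[F]_(2, K)) :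
    has_presentation g rels -> (forall x, \det (A x) = 1) ->
    (forall r, rels r -> word_mx A r = 1 /\ fox A B r = 0) ->
  exists rho Delta, [/\ @crossed_hom G rho Delta, forall a, \det (rho a) = 1,
    forall x, rho (g x) = A x & forall x, Delta (g x) = B x].
Proof.
move=> [gen pres] dA hr.
have Au x : A x \is a GRing.unit by rewrite -[_ \is a _]/(_ \in unitmx) unitmxE dA unitr1.
have ex a : exists w, eval_word g w == a by have [w <-] := gen a; exists w.
pose wd a := xchoose (ex a).
have wdK a : eval_word g (wd a) = a by apply/eqP/(xchooseP (ex a)).
have wdE a w : eval_word g w = a ->
    word_mx A (wd a) = word_mx A w /\ fox A B (wd a) = fox A B w.
  by move=> ew; apply: (fox_presented_eq Au hr); apply/pres; rewrite wdK.
have wdM a b : eval_word g (wd a ++ wd b) = (a * b)%g.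
  by rewrite /eval_word big_cat /= -!/(eval_word _ _) !wdK.
exists (fun a => word_mx A (wd a)), (fun a => fox A B (wd a)); split.
- split=> [|a b|a b].
  + have [|-> _] := @wdE 1%g [::]; first by rewrite /eval_word big_nil.
    by rewrite /word_mx big_nil.
  + by have [-> _] := wdE _ _ (wdM a b); rewrite word_mx_cat.
  + by have [_ ->] := wdE _ _ (wdM a b); rewrite fox_cat.
- move=> a; rewrite /word_mx; elim/big_ind: _ => [|M N dM dN|[x b] _].
  + exact: det1.
  + by rewrite det_mulmx dM dN mulr1.
  + by rewrite /letter_mx /=; case: b; rewrite ?det_inv dA ?invr1.
- move=> x; have [|-> _] := wdE (g x) [:: (x, false)].
    by rewrite /eval_word big_seq1.
  by rewrite /word_mx big_seq1.
- move=> x; have [|_ ->] := wdE (g x) [:: (x, false)].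
    by rewrite /eval_word big_seq1.
  by rewrite /= mulmx0 addr0.
Qed.

End CrossedHomomorphisms.

(** * Determinants of stacked blocks *)

Section NielsenInvariant.
Local Open Scope ring_scope.

Variable F : fieldType.

(** Sylvester's identity: both sides are the determinant of the product, in
    either order, of one block matrix with a block transvection. *)
Lemma det_1DmulC m n (X : 'M[F]_(m, n)) (Y : 'M[F]_(n, m)) :
  \det (1%:M + X *m Y) = \det (1%:M + Y *m X).
Proof.
pose T := block_mx 1%:M X 0 1%:M; pose M := block_mx 1%:M (- X) Y 1%:M.
have dT : \det T = 1 by rewrite det_ublock !det1 mulr1.
have <- : \det (T *m M) = \det (1%:M + X *m Y).
  rewrite mulmx_block !(mul1mx, mul0mx, mulmx1, add0r) addNr.
  by rewrite det_lblock det1 mulr1.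
have <- : \det (M *m T) = \det (1%:M + Y *m X).
  rewrite mulmx_block !(mul1mx, mulmx0, mulmx1, addr0) addrN.
  by rewrite det_lblock det1 mul1r addrC.
by rewrite !det_mulmx dT mulr1 mul1r.
Qed.

Section Stack.
Variable N : nat.

(** All first rows of the blocks come before all second rows: a permutation of
    the blocks then acts by two copies of its permutation matrix, and its sign
    enters the determinant squared. *)
Definition stack K (f : 'I_N -> 'M[F]_(2, K)) : 'M[F]_(N + N, K) :=
  col_mx (\matrix_(a < N) row 0 (f a)) (\matrix_(a < N) row 1 (f a)).

Definition unit_stack (i : 'I_N) : 'M[F]_(N + N, 2) :=
  stack (fun a => (a == i)%:R%:M).

Lemma unit_stackTM K i (f : 'I_N -> 'M[F]_(2, K)) :
  (unit_stack i)^T *m stack f = f i.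
Proof.
rewrite /unit_stack /stack tr_col_mx mul_row_col.
apply/matrixP=> r c; rewrite !mxE.
rewrite (bigD1 i) //= big1 ?addr0 => [|a /negPf ai]; last first.
  by rewrite !mxE ai mul0rn mul0r.
rewrite (bigD1 i) //= big1 ?addr0 => [|a /negPf ai]; last first.
  by rewrite !mxE ai mul0rn mul0r.
rewrite !mxE eqxx.
have [->|->] : r = 0 \/ r = 1 by case: r => -[|[|[]]] // p; [left|right]; apply/val_inj.
  by rewrite eqxx /= !mulr1n mul1r mulr0n mul0r addr0.
by rewrite eqxx /= !mulr1n mul1r mulr0n mul0r add0r.
Qed.

Lemma unit_stackM K i (w : 'M[F]_(2, K)) :
  unit_stack i *m w = stack (fun a => if a == i then w else 0).
Proof.
rewrite /unit_stack /stack mul_col_mx.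
congr col_mx; apply/row_matrixP=> a; rewrite row_mul !rowK -row_mul; case: eqP => _.
all: by rewrite ?mul1mx // -scalemx1 scale0r mul0mx.
Qed.

Lemma stackD K (f g : 'I_N -> 'M[F]_(2, K)) :
  stack f + stack g = stack (fun a => f a + g a).
Proof.
rewrite /stack add_col_mx; congr col_mx; apply/row_matrixP=> a;
by rewrite linearD /= !rowK linearD.
Qed.

Lemma eq_stack K (f g : 'I_N -> 'M[F]_(2, K)) : f =1 g -> stack f = stack g.
Proof. by move=> e; congr col_mx; apply/row_matrixP=> a; rewrite !rowK e. Qed.

Lemma stack_mul K K' (f : 'I_N -> 'M[F]_(2, K)) (M : 'M_(K, K')) :
  stack f *m M = stack (fun a => f a *m M).
Proof.
rewrite /stack mul_col_mx; congr col_mx; apply/row_matrixP=> a;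
by rewrite row_mul !rowK row_mul.
Qed.

Lemma stack_unit_stackT : stack (fun a => (unit_stack a)^T) = 1%:M.
Proof.
pose f (a : 'I_N) : 'M[F]_(2, N + N) :=
  \matrix_(r < 2) if r == 0 then row a (usubmx 1%:M) else row a (dsubmx 1%:M).
have f1 : stack f = 1%:M.
  by rewrite -[RHS]vsubmxK; congr col_mx; apply/row_matrixP=> a; rewrite !rowK.
rewrite -[LHS]mulmx1 -f1 stack_mul; apply: eq_stack => a.
exact: unit_stackTM.
Qed.

Implicit Types f : 'I_N -> 'M[F]_(2, N + N).

Lemma det_stack_perm f (p : 'S_N) : \det (stack (fun a => f (p a))) = \det (stack f).
Proof.
have -> : stack (fun a => f (p a)) =
    block_mx (perm_mx p) 0 0 (perm_mx p) *m stack f.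
  rewrite /stack mul_block_col !mul0mx addr0 add0r -!row_permE.
  by congr col_mx; apply/matrixP=> a c; rewrite !mxE.
by rewrite det_mulmx det_ublock det_perm -expr2 sqrr_sign mul1r.
Qed.

(** Changing one block is a rank two update, whose determinant Sylvester's
    identity reduces to a 2 x 2 one. *)
Lemma det_stack_update f f' i (Z : 'M[F]_(2, N + N)) :
    f' i = f i + Z *m stack f -> (forall a, a != i -> f' a = f a) ->
  \det (stack f') = \det (1%:M + Z *m unit_stack i) * \det (stack f).
Proof.
move=> f'i f'a; rewrite -det_1DmulC -det_mulmx; congr (\det _).
rewrite mulmxDl mul1mx -mulmxA unit_stackM stackD; apply: eq_stack => a.
by case: eqP => [->//|/eqP/f'a ->]; rewrite addr0.
Qed.

Lemma det_stack_transvection f f' i j (D : 'M[F]_2) : j != i ->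
    f' i = f i + D *m f j -> (forall a, a != i -> f' a = f a) ->
  \det (stack f') = \det (stack f).
Proof.
move=> /negPf ji f'i f'a.
rewrite (@det_stack_update f f' i (D *m (unit_stack j)^T)) //.
  rewrite -mulmxA unit_stackTM ji -[0%:M]scalemx1 scale0r mulmx0 addr0.
  by rewrite det1 mul1r.
by rewrite -mulmxA unit_stackTM.
Qed.

Lemma det_stack_mull1 f f' i (C : 'M[F]_2) :
    f' i = C *m f i -> (forall a, a != i -> f' a = f a) ->
  \det (stack f') = \det C * \det (stack f).
Proof.
move=> f'i f'a.
rewrite (@det_stack_update f f' i ((C - 1%:M) *m (unit_stack i)^T)) //.
  by rewrite -mulmxA unit_stackTM eqxx mulmx1 addrC subrK.
by rewrite -mulmxA unit_stackTM mulmxBl mul1mx addrC subrK.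
Qed.

Lemma det_stack_mull f f' (C : 'I_N -> 'M[F]_2) :
    (forall a, f' a = C a *m f a) ->
  \det (stack f') = (\prod_a \det (C a)) * \det (stack f).
Proof.
move=> f'E; pose h (r : seq 'I_N) a := if a \in r then f' a else f a.
suff H r : uniq r ->
    \det (stack (h r)) = (\prod_(a <- r) \det (C a)) * \det (stack f).
  rewrite -big_enum -H ?enum_uniq //; congr (\det _); apply: eq_stack => a.
  by rewrite /h mem_enum.
elim: r => [|i r IH] /=; first by rewrite big_nil mul1r.
move=> /andP[/negPf ir /IH {}IH]; rewrite big_cons -mulrA -IH.
apply: (det_stack_mull1 (i := i)) => [|a /negPf ai]; first by rewrite /h in_cons eqxx ir /= f'E.
by rewrite /h in_cons ai.
Qed.

End Stack.

(** A multiplication is a block transvection, composed for a left multiplication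
    with the action of [rho] on a block; an inversion acts on a block by a
    matrix [- rho g], of determinant 1 because blocks have even size. *)
Lemma nielsen_det_stack N (G : groupType) (rho : G -> 'M[F]_2)
    (Delta : G -> 'M[F]_(2, N + N)) (x y : N.-tuple G) :
    crossed_hom rho Delta -> (forall a, \det (rho a) = 1) -> nielsen_equiv x y ->
  \det (stack (Delta \o tnth x)) = \det (stack (Delta \o tnth y)).
Proof.
move=> hD hdet; elim=> {x y} [x y|//|x y z _ -> _ -> //].
have [_ _ dM] := hD.
case=> [p|i j ji|i j ji|i].
- rewrite -(det_stack_perm _ p); congr (\det _); apply: eq_stack => a /=.
  by rewrite tnth_mktuple.
- apply: esym; apply: (det_stack_transvection (D := rho (tnth x i)) ji) => /= [|a ai].
    by rewrite tnth_mktuple eqxx dM.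
  by rewrite tnth_mktuple (negPf ai).
- rewrite -[LHS]mul1r -(hdet (tnth x j)); apply: esym.
  rewrite -(@det_stack_mull1 _ (Delta \o tnth x)
    (fun a => if a == i then rho (tnth x j) *m Delta (tnth x i) else Delta (tnth x a)) i);
    last 2 first.
  + by rewrite eqxx.
  + by move=> a /negPf ->.
  apply: (det_stack_transvection (D := 1%:M) ji) => /= [|a ai].
    by rewrite tnth_mktuple eqxx (negPf ji) dM mul1mx addrC.
  by rewrite tnth_mktuple (negPf ai).
- rewrite [RHS](@det_stack_mull1 _ (Delta \o tnth x) _ i (- rho (tnth x i)^-1%g)) /=.
  + by rewrite -scaleN1r detZ hdet sqrrN expr1n !mul1r.
  + by rewrite tnth_mktuple eqxx (crossed_homV hD).
  + by move=> a ai; rewrite tnth_mktuple (negPf ai).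
Qed.

End NielsenInvariant.

(** * Nielsen operations *)

Section NielsenMoves.
Variables (N : nat) (G : groupType).
Implicit Types (x y z : N.-tuple G) (i j : 'I_N) (g h : G).

Definition set_tnth x i h : N.-tuple G :=
  [tuple if a == i then h else tnth x a | a < N].

Lemma tnth_set x i h : tnth (set_tnth x i h) i = h.
Proof. by rewrite tnth_mktuple eqxx. Qed.

Lemma tnth_set_neq x i h a : a != i -> tnth (set_tnth x i h) a = tnth x a.
Proof. by rewrite tnth_mktuple => /negPf ->. Qed.

Lemma set_tnth_id x i : set_tnth x i (tnth x i) = x.
Proof. by apply: eq_from_tnth => a; rewrite tnth_mktuple; case: eqP => // ->. Qed.

Lemma set_set_tnth x i h g : set_tnth (set_tnth x i h) i g = set_tnth x i g.
Proof. by apply: eq_from_tnth => a; rewrite !tnth_mktuple; case: eqP. Qed.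

Lemma set_tnthC x i j h g : i != j ->
  set_tnth (set_tnth x i h) j g = set_tnth (set_tnth x j g) i h.
Proof.
move=> ij; apply: eq_from_tnth => a; rewrite !tnth_mktuple.
by case: (a =P j) => // ->; rewrite eq_sym (negPf ij).
Qed.

Lemma nielsen_refl x : nielsen_equiv x x.
Proof. exact: rt_refl. Qed.

Lemma nielsen_trans x y z :
  nielsen_equiv x y -> nielsen_equiv y z -> nielsen_equiv x z.
Proof. exact: rt_trans. Qed.

Lemma nielsen_set_inv x i h :
  nielsen_equiv (set_tnth x i h) (set_tnth x i h^-1).
Proof.
apply: rt_step.
by have := NielsenInv (set_tnth x i h) i; rewrite -/(set_tnth _ _ _) tnth_set set_set_tnth.
Qed.

Lemma nielsen_set_mulr x i j h : j != i ->
  nielsen_equiv (set_tnth x i h) (set_tnth x i (h * tnth x j)).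
Proof.
move=> ji; apply: rt_step; have := NielsenMulr (set_tnth x i h) ji.
by rewrite -/(set_tnth _ _ _) tnth_set tnth_set_neq // set_set_tnth.
Qed.

(** Invert entry [j], multiply, and invert it back. *)
Lemma nielsen_set_divr x i j h : j != i ->
  nielsen_equiv (set_tnth x i h) (set_tnth x i (h * (tnth x j)^-1)).
Proof.
move=> ji; have ij : i != j by rewrite eq_sym.
have E k : set_tnth x i k = set_tnth (set_tnth x i k) j (tnth x j).
  by rewrite -[LHS](set_tnth_id _ j) tnth_set_neq.
suff: nielsen_equiv (set_tnth (set_tnth x i h) j (tnth x j)^-1)
    (set_tnth (set_tnth x i (h * (tnth x j)^-1)) j (tnth x j)^-1).
  move=> H; rewrite (E h) (E (h * _)).
  apply: nielsen_trans (nielsen_set_inv _ _ _) (nielsen_trans H _).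
  have := nielsen_set_inv (set_tnth x i (h * (tnth x j)^-1)) j (tnth x j)^-1.
  by rewrite invgK.
rewrite !(@set_tnthC x i j) //.
have := @nielsen_set_mulr (set_tnth x j (tnth x j)^-1) i j h ji.
by rewrite tnth_set.
Qed.

Lemma nielsen_sym x y : nielsen_equiv x y -> nielsen_equiv y x.
Proof.
elim=> {x y} [x y|x|x y z _ yx _ zy]; last 2 first.
- exact: nielsen_refl.
- exact: nielsen_trans zy yx.
case=> [p|i j ji|i j ji|i].
- apply: rt_step; set t := [tuple _ | _ < _].
  have {1}-> : x = [tuple tnth t (p^-1%g a) | a < N].
    by apply: eq_from_tnth => a; rewrite !tnth_mktuple permKV.
  exact: NielsenPerm.
- have := nielsen_set_divr x (tnth x i * tnth x j) ji.
  by rewrite mulgK set_tnth_id.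
- apply: nielsen_trans (nielsen_set_inv x i (tnth x j * tnth x i)) _.
  apply: nielsen_trans (nielsen_set_mulr x _ ji) _.
  have := nielsen_set_inv x i ((tnth x j * tnth x i)^-1 * tnth x j).
  by rewrite invMg mulgVK invgK set_tnth_id.
- by have := nielsen_set_inv x i (tnth x i)^-1; rewrite invgK set_tnth_id.
Qed.

(** Closed under products and inverses, this property extends from single entries
    to the whole subgroup that the entries other than [i] generate. *)
Definition multiplier x i g : Prop :=
  forall h, nielsen_equiv (set_tnth x i h) (set_tnth x i (h * g)).

Lemma multiplier1 x i : multiplier x i 1.
Proof. by move=> h; rewrite mulg1; apply: nielsen_refl. Qed.

Lemma multiplierM x i g h :
  multiplier x i g -> multiplier x i h -> multiplier x i (g * h).
Proof. by move=> mg mh k; rewrite mulgA; apply: nielsen_trans (mg k) (mh _). Qed.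

Lemma multiplierV x i g : multiplier x i g -> multiplier x i g^-1.
Proof. by move=> mg h; apply: nielsen_sym; have := mg (h * g^-1); rewrite mulgVK. Qed.

Lemma multiplierX x i g n : multiplier x i g -> multiplier x i (g ^+ n).
Proof.
move=> mg; elim: n => [|n IH]; rewrite ?expg0 ?expgS; first exact: multiplier1.
exact: multiplierM.
Qed.

Lemma multiplier_tnth x i j : j != i -> multiplier x i (tnth x j).
Proof. by move=> ji h; apply: nielsen_set_mulr. Qed.

Lemma multiplier_mull x i g h :
  multiplier x i g -> nielsen_equiv (set_tnth x i h) (set_tnth x i (g * h)).
Proof.
move=> mg; apply: nielsen_trans (nielsen_set_inv _ _ _) _.
rewrite -[g * h]invgK; apply: nielsen_trans (nielsen_set_inv _ _ _).
by rewrite invMg; apply: multiplierV.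
Qed.

Lemma nielsen_inv_entries x y :
  (forall a, tnth y a = tnth x a \/ tnth y a = (tnth x a)^-1) ->
  nielsen_equiv x y.
Proof.
move=> xy; pose m (r : seq 'I_N) := [tuple if a \in r then tnth y a else tnth x a | a < N].
suff H r : nielsen_equiv x (m r).
  have -> : y = m (enum 'I_N); last exact: H.
  by apply: eq_from_tnth => a; rewrite tnth_mktuple mem_enum.
elim: r => [|i r IH].
  have -> : m [::] = x; last exact: nielsen_refl.
  by apply: eq_from_tnth => a; rewrite tnth_mktuple.
apply: nielsen_trans IH _.
have -> : m (i :: r) = set_tnth (m r) i (tnth y i).
  by apply: eq_from_tnth => a; rewrite !tnth_mktuple in_cons; case: eqP => [->|].
rewrite -{1}(set_tnth_id (m r) i) tnth_mktuple.
case: ifP => _; first exact: nielsen_refl.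
by case: (xy i) => ->; [apply: nielsen_refl | apply: nielsen_set_inv].
Qed.

Lemma nielsen_perm_entries x y (p : 'S_N) :
  (forall a, tnth y a = tnth x (p a) \/ tnth y a = (tnth x (p a))^-1) ->
  nielsen_equiv x y.
Proof.
move=> xy; apply: nielsen_trans (rt_step _ _ _ _ (NielsenPerm x p)) _.
by apply: nielsen_inv_entries => a; rewrite tnth_mktuple.
Qed.

End NielsenMoves.

(** * Integer powers of elements of finite order *)

Section IntegerPowers.
Variables (G : groupType) (x : G) (n : nat).
Hypotheses (n_gt0 : 0 < n) (xn : x ^+ n = 1).

Lemma expg_modn m : x ^+ (m %% n) = x ^+ m.
Proof. by rewrite {2}(divn_eq m n) expgD mulnC expgM xn expg1n mul1g. Qed.

Definition nat_residue (z : int) : nat := `|(z %% n)%Z|%N.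

Lemma nat_residueE z : ((nat_residue z)%:Z = (z %% n)%Z)%R.
Proof. by rewrite /nat_residue gez0_abs // modz_ge0 // -lt0n. Qed.

Lemma expgz_residue z : expgz x z = x ^+ nat_residue z.
Proof.
case: z => [m|m] /=.
  by rewrite /nat_residue modz_nat absz_nat expg_modn.
have : n %| nat_residue (Negz m) + m.+1.
  rewrite -[_ %| _]/(n%:Z %| (nat_residue (Negz m) + m.+1)%:Z)%Z.
  rewrite PoszD nat_residueE; apply/dvdz_mod0P.
  by rewrite modzDml NegzE addNr mod0z.
case/dvdnP=> c e; apply: (mulIg (x ^+ m.+1)).
by rewrite mulVg -expgD e mulnC expgM xn expg1n.
Qed.

Lemma coprime_residue z : coprimez z n -> coprime (nat_residue z) n.
Proof.
by rewrite /coprime -[gcdn _ _]/`|gcdz (nat_residue z) n| nat_residueE gcdz_modl => /eqP ->.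
Qed.

Lemma expgzN z : expgz x (- z)%R = (expgz x z)^-1.
Proof.
case: z => [[|m]|m] /=; first by rewrite expg0 invg1.
  by [].
by rewrite invgK.
Qed.

Lemma expgz_eqmod_sign a b : eqmod_sign n a b ->
  expgz x b = expgz x a \/ expgz x b = (expgz x a)^-1.
Proof.
case=> e; [left|right; rewrite -expgzN].
  by rewrite !expgz_residue /nat_residue e.
rewrite !expgz_residue /nat_residue; congr (x ^+ `|_|).
by rewrite -{1}[b]opprK -modzNm e modzNm.
Qed.

(** Euler's theorem provides the inverse exponent. *)
Lemma expg_coprime_root m : coprime m n -> exists w, (x ^+ m) ^+ w = x.
Proof.
move=> mn; exists (m ^ (totient n).-1)%N; rewrite -expgM -expnS prednK ?totient_gt0 //.
by rewrite -expg_modn (Euler_exp_totient mn) expg_modn.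
Qed.

End IntegerPowers.

(** * Matrices with prescribed traces and product 1 *)

Section ProductOfMatrices.
Local Open Scope ring_scope.

Variable F : fieldType.
Implicit Types (M : 'M[F]_2) (a b c d lam mu : F).

Definition mx22 a b c d : 'M[F]_2 :=
  \matrix_(i, j) if i == 0 then (if j == 0 then a else b)
                 else (if j == 0 then c else d).

Lemma mx22E M : M = mx22 (M 0 0) (M 0 1) (M 1 0) (M 1 1).
Proof.
apply/matrixP=> i j; rewrite mxE.
by case: i j => -[|[|//]] pi [[|[|//]] pj] /=; congr (M _ _); apply/val_inj.
Qed.

Lemma mulmx22 a b c d a' b' c' d' :
  mx22 a b c d * mx22 a' b' c' d' =
    mx22 (a * a' + b * c') (a * b' + b * d') (c * a' + d * c') (c * b' + d * d').
Proof.
apply/matrixP=> i j; rewrite !mxE !big_ord_recl big_ord0 !mxE /= addr0.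
by case: i j => -[|[|//]] pi [[|[|//]] pj].
Qed.

Lemma tr_mx22 a b c d : \tr (mx22 a b c d) = a + d.
Proof. by rewrite /mxtrace !big_ord_recl big_ord0 !mxE /= addr0. Qed.

Lemma det_mx22 a b c d : \det (mx22 a b c d) = a * d - b * c.
Proof.
rewrite (expand_det_row _ 0) !big_ord_recl big_ord0 !mxE /= addr0.
rewrite /cofactor !det_mx11 !mxE /= addn0 expr0 mul1r.
by rewrite expr1 mulN1r mulrN.
Qed.

Lemma scalar_mx22 a : a%:M = mx22 a 0 0 a.
Proof. by rewrite (mx22E a%:M) !mxE. Qed.

Lemma cayley_hamilton22 M : M ^+ 2 = \tr M *: M - (\det M)%:M.
Proof.
rewrite (mx22E M); move: (M 0 0) (M 0 1) (M 1 0) (M 1 1) => a b c d.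
rewrite expr2 mulmx22 tr_mx22 det_mx22 -mul_scalar_mx !scalar_mx22.
rewrite -[_ *m _]/(_ * _) mulmx22.
apply/matrixP=> i j; rewrite !mxE; case: (i == 0); case: (j == 0); ring.
Qed.

Lemma det_subr1_mx22 M : \det (M - 1) = 1 + \det M - \tr M.
Proof.
rewrite (mx22E M); move: (M 0 0) (M 0 1) (M 1 0) (M 1 1) => a b c d.
have -> : mx22 a b c d - 1 = mx22 (a - 1) b c (d - 1).
  rewrite -[1]/(1%:M) scalar_mx22; apply/matrixP=> i j; rewrite !mxE.
  by case: (i == 0); case: (j == 0); rewrite ?subr0.
rewrite tr_mx22 !det_mx22; ring.
Qed.

Lemma inv_mx22 a b c d :
  a * d - b * c = 1 -> (mx22 a b c d)^-1 = mx22 d (- b) (- c) a.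
Proof.
move=> h; have u : mx22 a b c d \is a GRing.unit.
  by rewrite -[_ \is a _]/(_ \in unitmx) unitmxE det_mx22 h unitr1.
apply: (mulrI u); rewrite divrr // mulmx22 -[LHS]/(1%:M) scalar_mx22 -h.
by congr mx22; ring.
Qed.

Lemma tr_inv_mx22 M : \det M = 1 -> \tr M^-1 = \tr M.
Proof.
rewrite (mx22E M) det_mx22 => /inv_mx22 ->; rewrite !tr_mx22; exact: addrC.
Qed.

Section Powers.
Variables (M : 'M[F]_2) (lam : F).
Hypotheses (lam0 : lam != 0) (detM : \det M = 1) (trM : \tr M = lam + lam^-1).

(** By Cayley-Hamilton both sides satisfy the same recurrence of order two. *)
Lemma tr_expr_mx22 n : \tr (M ^+ n) = lam ^+ n + lam ^- n.
Proof.
suff: \tr (M ^+ n) = lam ^+ n + lam ^- n /\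
      \tr (M ^+ n.+1) = lam ^+ n.+1 + lam ^- n.+1 by case.
elim: n => [|n [IH1 IH2]].
  by rewrite expr0 mxtrace1 expr1 trM !expr1 invr1.
split=> //; have -> : M ^+ n.+2 = M ^+ n * M ^+ 2 by rewrite -exprD addn2.
rewrite cayley_hamilton22 detM mulrBr mulr1.
rewrite -[M ^+ n * _]/(_ *m _) -scalemxAr -[_ *m M]/(_ * _) -exprSr.
rewrite linearB linearZ /= IH1 IH2 trM -!exprVn !exprS.
have: lam * lam^-1 = 1 by rewrite divff.
move: (lam^-1) => mu e.
have -> : (lam + mu) * (lam * lam ^+ n + mu * mu ^+ n) =
  lam ^+ n * (lam * lam) + mu ^+ n * (mu * mu) + (lam * mu) * (lam ^+ n + mu ^+ n).
  by ring.
by rewrite e; ring.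
Qed.

Lemma det_expr_subr1_mx22 n : \det (M ^+ n - 1) = 2 - lam ^+ n - lam ^- n.
Proof.
rewrite det_subr1_mx22 tr_expr_mx22.
have -> : \det (M ^+ n) = 1.
  by elim: n => [|n IH]; rewrite ?det1 // exprS det_mulmx IH detM mulr1.
ring.
Qed.

(** The condition on [lam] makes the eigenvalues distinct; without it [M] could
    be, up to sign, a nontrivial unipotent matrix. *)
Lemma expr_mx22_eq1 n : lam ^+ 2 != 1 -> lam ^+ n = 1 -> M ^+ n = 1.
Proof.
move=> lam2 lamn.
have d0 : lam - lam^-1 != 0.
  apply: contraNneq lam2 => /eqP; rewrite subr_eq0 => /eqP e.
  by rewrite expr2 {2}e divff.
(* Lagrange interpolation of X ^ m at the two eigenvalues. *)
have H m : (lam - lam^-1) *: M ^+ m = (lam ^+ m - lam ^- m) *: M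
    + (lam * lam ^- m - lam^-1 * lam ^+ m) *: 1.
  elim: m => [|m IH].
    by rewrite !expr0 invr1 subrr scale0r add0r !mulr1.
  rewrite exprSr -[_ * M]/(_ *m M) scalemxAl IH mulmxDl -!scalemxAl mul1mx.
  rewrite -[M *m M]/(M ^+ 2) cayley_hamilton22 detM trM -scalemx1.
  rewrite scalerBr !scalerA addrAC -scalerDl -scaleNr -!exprVn !exprS.
  have: lam * lam^-1 = 1 by rewrite divff.
  move: (lam^-1) => mu e; congr (_ *: _ + _ *: _).
    by ring.
  transitivity (- (lam ^+ m - mu ^+ m) * (lam * mu)); last by ring.
  by rewrite e; ring.
by apply: (scalerI d0); rewrite H lamn invr1 subrr scale0r add0r !mulr1.
Qed.

End Powers.

(** All factors are diagonal except three.  The factor at [i1] is upper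
    triangular and not diagonal, the one at [i2] is lower triangular with a free
    entry [c], and the one at [i3] is the inverse of the cyclic product of all
    the others.  Its determinant is 1 and its trace is an affine function of [c]
    of nonzero slope, so that a suitable [c] gives it the required trace. *)
Lemma prod_mx22_eq1_exists (T : eqType) (r : seq T) (lam : T -> F) i1 i2 i3 :
    (forall i, lam i != 0) -> uniq r ->
    i1 \in r -> i2 \in r -> i3 \in r -> i1 != i2 -> i1 != i3 -> i2 != i3 ->
  exists A : T -> 'M[F]_2,
    [/\ forall i, \det (A i) = 1, forall i, \tr (A i) = lam i + (lam i)^-1,
        forall i, i \notin [:: i1; i2; i3] -> A i = mx22 (lam i) 0 0 (lam i)^-1
      & \prod_(i <- r) A i = 1].
Proof.
move=> lam0 ur r1 r2 r3 n12 n13 n23.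
pose dg i := mx22 (lam i) 0 0 (lam i)^-1.
pose tri c i := if i == i1 then mx22 (lam i) 1 0 (lam i)^-1
                else if i == i2 then mx22 (lam i) 0 c (lam i)^-1 else dg i.
have diagP (s : seq T) :
    exists xy, [/\ \prod_(i <- s) dg i = mx22 xy.1 0 0 xy.2, xy.1 != 0 & xy.2 != 0].
  elim: s => [|i s [[x y] /= [IH x0 y0]]].
    exists (1, 1); rewrite big_nil /= oner_neq0; split=> //.
    by rewrite -scalar_mx22.
  exists (lam i * x, (lam i)^-1 * y) => /=; rewrite !mulf_neq0 ?invr_eq0 //.
  by rewrite big_cons IH mulmx22 !(mulr0, mul0r, addr0, add0r).
have prod_dg c s : i1 \notin s -> i2 \notin s ->
    \prod_(i <- s) tri c i = \prod_(i <- s) dg i.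
  move=> h1 h2; apply: eq_big_seq => i si; rewrite /tri.
  case: eqP => [e|_]; first by rewrite -e si in h1.
  by case: eqP => [e|//]; rewrite -e si in h2.
have det_tri c i : \det (tri c i) = 1.
  by rewrite /tri; do 2?case: ifP => _;
     rewrite det_mx22 ?(mulr0, mul0r) subr0 divff.
have det_prod c s : \det (\prod_(i <- s) tri c i) = 1.
  elim/big_ind: _ => [|M N dM dN|//]; first exact: det1.
  by rewrite det_mulmx dM dN mulr1.
have prod_unit c s : \prod_(i <- s) tri c i \is a GRing.unit.
  by rewrite -[_ \is a _]/(_ \in unitmx) unitmxE det_prod unitr1.
case/splitPr: r3 ur r1 r2 => L L' ur r1 r2.
have{r1 r2 ur} [r1 r2 ur i3L] :
    [/\ i1 \in L' ++ L, i2 \in L' ++ L, uniq (L' ++ L) & i3 \notin L' ++ L].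
  move: ur r1 r2; rewrite uniq_catC /= => /andP[n3 u].
  rewrite ![_ \in _ ++ i3 :: _]mem_cat !in_cons (negPf n13) (negPf n23) /=.
  by move=> r1 r2; split=> //; rewrite mem_cat orbC.
have [c trc] : exists c, \tr (\prod_(i <- L' ++ L) tri c i) = lam i3 + (lam i3)^-1.
  move: r1 ur; case/splitPr: r2 => X Y r1; rewrite uniq_catC => /= /andP[n2 uYX].
  have{r1}: i1 \in Y ++ X.
    by move: r1; rewrite !mem_cat in_cons (negPf n12) orbC.
  (* Cyclically, the factors other than the one at i2 form an upper triangular
     product Z, whose corner entry is the slope. *)
  have tr_cyc c : \tr (\prod_(i <- X ++ i2 :: Y) tri c i) =
      \tr (tri c i2 * \prod_(i <- Y ++ X) tri c i).
    rewrite !big_cat big_cons /= [X in _ = \tr X]mulrA.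
    exact: mxtrace_mulC.
  move: (Y ++ X) uYX n2 tr_cyc => Z uZ n2 tr_cyc rZ.
  case/splitPr: rZ uZ n2 tr_cyc => P Q; rewrite uniq_catC /= => /andP[].
  rewrite !mem_cat !in_cons !negb_or => /andP[n1Q n1P] _.
  rewrite eq_sym => /and3P[n2P _ n2Q] tr_cyc.
  have [[p1 p2] /= [eP p10 p20]] := diagP P.
  have [[q1 q2] /= [eQ q10 q20]] := diagP Q.
  exists ((lam i3 + (lam i3)^-1 - lam i2 * (p1 * lam i1 * q1)
      - (lam i2)^-1 * (p2 * (lam i1)^-1 * q2)) / (p1 * q2)).
  rewrite tr_cyc big_cat big_cons /= !prod_dg // eP eQ /tri !eqxx.
  rewrite eq_sym (negPf n12) !mulmx22 tr_mx22.
  rewrite !(mulr0, mul0r, addr0, add0r, mulr1, mul1r).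
  rewrite divfK ?mulf_neq0 //; ring.
exists (fun i => if i == i3 then (\prod_(i <- L' ++ L) tri c i)^-1 else tri c i).
split=> [i|i|i|].
- by case: eqP => // _; rewrite det_inv det_prod invr1.
- case: eqP => [->|_]; first by rewrite tr_inv_mx22 ?det_prod.
  by rewrite /tri; do 2?case: ifP => _; rewrite tr_mx22.
- by rewrite !inE !negb_or => /and3P[/negPf n1 /negPf n2 /negPf ->]; rewrite /tri n1 n2.
rewrite big_cat big_cons eqxx /=.
have out s : i3 \notin s -> \prod_(i <- s) (if i == i3
    then (\prod_(i <- L' ++ L) tri c i)^-1 else tri c i) = \prod_(i <- s) tri c i.
  by move=> n3; apply: eq_big_seq => i si; case: eqP => // e; rewrite -e si in n3.
move: i3L; rewrite mem_cat negb_or => /andP[n3' n3].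
rewrite !out // big_cat /= invrM ?prod_unit // !mulrA mulrV ?prod_unit // mul1r.
by rewrite mulVr ?prod_unit.
Qed.

End ProductOfMatrices.

(** * Roots of unity *)

Section RootsOfUnity.
Local Open Scope ring_scope.

(** Iterating the relation along powers of [u] and [v] gives
    [g (u ^ r) * Ku ^+ r = g (v ^ r) * Kv ^+ r].  For [r] the totient of [n] both
    powers are 1 modulo [n], so [Ku] and [Kv] are positive with equal [r]-th
    powers. *)
Lemma eq_of_proportional (F : numFieldType) (n u v : nat) (g : nat -> F)
    (Ku Kv : F) :
    (0 < n)%N -> coprime u n -> coprime v n ->
    (forall a b, a = b %[mod n] -> g a = g b) ->
    g 1%N != 0 -> 0 < Ku -> 0 < Kv ->
    (forall p, coprime p n -> g (p * u)%N * Ku = g (p * v)%N * Kv) ->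
  g u = g v.
Proof.
move=> n0 un vn gmod g1 Ku0 Kv0 H.
have Hr r p : coprime p n -> g (p * u ^ r)%N * Ku ^+ r = g (p * v ^ r)%N * Kv ^+ r.
  elim: r p => [|r IH] p pn; first by rewrite !expr0.
  rewrite !expnS !exprSr !mulrA !mulnA IH ?coprimeMl ?pn //.
  by rewrite mulrAC mulnAC H ?coprimeMl ?pn ?coprimeXl // mulrAC (mulnAC p).
have := Hr (totient n) 1%N (coprime1n n).
rewrite !mul1n (gmod _ 1%N (Euler_exp_totient un)) (gmod _ 1%N (Euler_exp_totient vn)).
move/(mulfI g1) => /eqP; rewrite eqrXn2 ?totient_gt0 ?ltW // => /eqP e.
have := H 1%N (coprime1n n); rewrite !mul1n e => /mulIf; apply.
by rewrite gt_eqF.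
Qed.

Section Primitive.
Variables (n : nat) (z : algC).
Hypothesis zn : n.-primitive_root z.

(** The square of the distance between 1 and [z ^+ a] on the unit circle, written
    as the polynomial [(1 - z ^+ a) * (1 - z ^- a)] in [z] and its inverse. *)
Definition chord_sq (a : nat) : algC := 2 - z ^+ a - z ^- a.

Lemma prim_root_neq0 : z != 0.
Proof. by rewrite (prim_root_eq0 zn) -lt0n (prim_order_gt0 zn). Qed.

Lemma chord_sq_mod a b : a = b %[mod n] -> chord_sq a = chord_sq b.
Proof. by move=> e; rewrite /chord_sq -(prim_expr_mod zn a) e (prim_expr_mod zn). Qed.

Lemma chord_sq_gt0 a : (1 < n)%N -> coprime a n -> 0 < chord_sq a.
Proof.
move=> n1 an.
have -> : chord_sq a = `|1 - z ^+ a| ^+ 2.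
  have za : `|z ^+ a| = 1.
    apply/eqP; rewrite -(@pexpr_eq1 _ _ n) ?normr_ge0 ?(prim_order_gt0 zn) //.
    by rewrite -normrX exprAC (prim_expr_order zn) expr1n normr1.
  rewrite normCK rmorphB rmorph1 /= -[(z ^+ a)^*]mulr1.
  have e : z ^+ a * (z ^+ a)^* = 1 by rewrite -normCK za expr1n.
  have -> : (z ^+ a)^* = z ^- a.
    by apply: (mulfI (expf_neq0 a prim_root_neq0)); rewrite e divff ?expf_neq0 ?prim_root_neq0.
  rewrite mulr1 /chord_sq mulrBl mul1r mulrBr mulr1 divff ?expf_neq0 ?prim_root_neq0 //.
  ring.
rewrite exprn_gt0 // normr_gt0 subr_eq0 eq_sym -(prim_order_dvd zn).
apply: contraL n1 => na; rewrite -leqNgt.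
by move: an; rewrite /coprime; move/gcdn_idPr: na => -> /eqP ->.
Qed.

Lemma chord_sq_inj a b : chord_sq a = chord_sq b ->
  a = b %[mod n] \/ (n %| a + b)%N.
Proof.
move=> e; have z0 := prim_root_neq0.
suff /eqP : (z ^+ a - z ^+ b) * (z ^+ (a + b) - 1) = 0.
  rewrite mulf_eq0 !subr_eq0 (eq_prim_root_expr zn) -(prim_order_dvd zn).
  by case/orP => [/eqP|]; [left|right].
have za := expf_neq0 a z0; have zb := expf_neq0 b z0.
have -> : (z ^+ a - z ^+ b) * (z ^+ (a + b) - 1) =
    z ^+ a * z ^+ b * (chord_sq b - chord_sq a).
  rewrite exprD /chord_sq; move: za zb; move: (z ^+ a) (z ^+ b) => x y x0 y0.
  by field; rewrite x0.
by rewrite e subrr mulr0.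
Qed.

End Primitive.
End RootsOfUnity.

Section RootMatrices.
Local Open Scope ring_scope.

Lemma expr_diag_mx22 (F : fieldType) (lam : F) n :
  mx22 lam 0 0 lam^-1 ^+ n = mx22 (lam ^+ n) 0 0 (lam ^- n).
Proof.
elim: n => [|n IH]; first by rewrite !expr0 invr1 -scalar_mx22.
rewrite exprSr IH mulmx22 !(mulr0, mul0r, addr0, add0r).
by rewrite -!exprVn -!exprSr.
Qed.

(** The diagonal factors have order [gamma i] by construction, and the other three
    because their eigenvalues are distinct, which is where [2 < gamma i] is
    needed.  The geometric sum over a full period vanishes since [A i - 1] is
    invertible. *)
Lemma root_matrices_exist (T : eqType) (r : seq T) (gamma : T -> nat)
    (lam : T -> algC) i1 i2 i3 :
    uniq r -> (forall i, (1 < gamma i)%N) ->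
    (forall i, (gamma i).-primitive_root (lam i)) ->
    i1 \in r -> i2 \in r -> i3 \in r -> i1 != i2 -> i1 != i3 -> i2 != i3 ->
    (forall i, i \in [:: i1; i2; i3] -> (2 < gamma i)%N) ->
  exists A : T -> 'M[algC]_2,
    [/\ forall i, \det (A i) = 1,
        forall i, \sum_(t < gamma i) A i ^+ t = 0,
        forall i n, \det (\sum_(t < n) A i ^+ t) * chord_sq (lam i) 1 =
                    chord_sq (lam i) n
      & \prod_(i <- r) A i = 1].
Proof.
move=> ur gam1 prim r1 r2 r3 n12 n13 n23 gam3.
have lam0 i := prim_root_neq0 (prim i).
have [A [dA tA diagA prodA]] := prod_mx22_eq1_exists lam0 ur r1 r2 r3 n12 n13 n23.
have dX i n : \det (A i ^+ n - 1) = chord_sq (lam i) n.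
  exact: det_expr_subr1_mx22 (lam0 i) (dA i) (tA i) n.
have c0 i : chord_sq (lam i) 1 != 0.
  by rewrite gt_eqF // (chord_sq_gt0 (prim i)) // coprime1n.
have AX i : A i ^+ gamma i = 1.
  have [i3r|/diagA ->] := boolP (i \in [:: i1; i2; i3]).
    apply: (expr_mx22_eq1 (lam0 i) (dA i) (tA i)) (prim_expr_order (prim i)).
    by rewrite -(prim_order_dvd (prim i)) gtnNdvd // gam3.
  by rewrite expr_diag_mx22 (prim_expr_order (prim i)) invr1 -scalar_mx22.
exists A; split=> // i.
  have u : A i - 1 \is a GRing.unit.
    by rewrite -[_ \is a _]/(_ \in unitmx) unitmxE -(expr1 (A i)) dX unitfE.
  by apply: (mulrI u); rewrite mulr0 -subrX1 AX subrr.
by move=> n; rewrite -(dX i 1%N) -(dX i n) expr1 subrX1 det_mulmx mulrC.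
Qed.

End RootMatrices.

(** * Generating systems of the presented group *)

Section FuchsianGroup.
Variables (l q : nat) (gamma : 'I_l -> nat) (W : word 'I_q).
Variables (G : groupType) (s : 'I_l -> G) (d : 'I_q -> G).
Hypothesis gamma_ge2 : forall i, 2 <= gamma i.
Hypothesis hG : has_presentation (fuchsian_generators s d)
                  (fuchsian_relator gamma W).

Lemma gamma_gt0 i : 0 < gamma i. Proof. exact: ltnW. Qed.

Lemma expg_gamma i : s i ^+ gamma i = 1.
Proof.
have [_ pres] := hG.
have /pres : presented_eq (fuchsian_relator gamma W)
    (nseq (gamma i) (inl i, false)) [::] by apply: PresRel; constructor.
rewrite /eval_word big_nil big_nseq /= => <-.
by elim: (gamma i) => [|n IH]; rewrite ?expg0 // expgS IH.
Qed.

Lemma long_relation :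
  (\prod_(i <- enum 'I_l) s i) * eval_word d W = 1.
Proof.
have [_ pres] := hG.
have /pres : presented_eq (fuchsian_relator gamma W)
    ([seq (inl i, false) | i <- enum 'I_l] ++ [seq (inr a.1, a.2) | a <- W]) [::].
  by apply: PresRel; constructor.
by rewrite /eval_word big_nil big_cat !big_map.
Qed.

Section System.
Variables (j : 'I_l) (u : 'I_l -> int).

Lemma tnth_extended_lshift i : tnth (extended_system s d j u) (lshift q i) =
  expgz (s (lift j i)) (u (lift j i)).
Proof. by rewrite tnth_mktuple; have := unsplitK (inl i : 'I_l.-1 + 'I_q); move=> /= ->. Qed.

Lemma tnth_extended_rshift m :
  tnth (extended_system s d j u) (rshift l.-1 m) = d m.
Proof. by rewrite tnth_mktuple; have := unsplitK (inr m : 'I_l.-1 + 'I_q); move=> /= ->. Qed.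

(** The long relation writes [s j] as a product in which [s k] occurs exactly
    once, so [s j] can replace [s k]. *)
Lemma exchange_generator i0 : standard_exponents gamma j u ->
    eqmod_sign (gamma (lift j i0)) (u (lift j i0)) 1%R ->
  nielsen_equiv (extended_system s d j u)
    (set_tnth (extended_system s d j u) (lshift q i0) (s j)).
Proof.
set U := extended_system s d j u; set k := lift j i0; set a0 := lshift q i0.
move=> hu uk1.
have jk : j != k by apply: neq_lift.
have step1 : nielsen_equiv U (set_tnth U a0 (s k)^-1).
  apply: nielsen_trans (nielsen_set_inv _ _ _).
  apply: nielsen_inv_entries => a; case: (eqVneq a a0) => [->|/tnth_set_neq ->]; last by left.
  rewrite tnth_set tnth_extended_lshift.
  by have := expgz_eqmod_sign (gamma_gt0 k) (expg_gamma k) uk1.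
have mult_s i : i != j -> i != k -> multiplier U a0 (s i).
  case: (unliftP j i) => [i' ->|-> /eqP//] _ ik.
  have co := hu (lift j i'); rewrite eq_sym neq_lift in co; have {}co := co isT.
  have [w <-] := expg_coprime_root (gamma_gt0 _) (expg_gamma (lift j i'))
    (coprime_residue (gamma_gt0 _) co).
  rewrite -(expgz_residue (gamma_gt0 _) (expg_gamma _)).
  apply: multiplierX; rewrite -tnth_extended_lshift; apply: multiplier_tnth.
  by apply: contraNneq ik => /lshift_inj ->.
have mult_seq r : j \notin r -> k \notin r -> multiplier U a0 (\prod_(i <- r) s i).
  elim: r => [|i r IH]; first by rewrite big_nil => _ _; apply: multiplier1.
  rewrite !in_cons !negb_or big_cons => /andP[ji jr] /andP[ki kr].
  by apply: multiplierM (IH jr kr); apply: mult_s; rewrite eq_sym.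
have mult_W : multiplier U a0 (eval_word d W).
  rewrite /eval_word; elim/big_ind: _ => [|g h|[m b] _].
  - exact: multiplier1.
  - exact: multiplierM.
  have mm : multiplier U a0 (d m).
    rewrite -tnth_extended_rshift; apply: multiplier_tnth.
    by rewrite -(inj_eq val_inj) /= gtn_eqF // ltn_addr.
  by case: b => /=; [apply: multiplierV|].
(* Solving the long relation for s j; the two cases below are whether s k comes
   after or before s j. *)
have solve (a x b : G) : a * x * b = 1 -> x = a^-1 * b^-1.
  by move=> e; apply: (mulgI a); apply: (mulIg b); rewrite e mulgA mulgVK mulgV.
suff [g1 [g2 [m1 m2 ->]]] : exists g1 g2,
    [/\ multiplier U a0 g1, multiplier U a0 g2 & s j = g1 * (s k)^-1 * g2].
  apply: nielsen_trans step1 (nielsen_trans _ (m2 _)).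
  exact: multiplier_mull.
have := long_relation; have : k \in enum 'I_l by rewrite mem_enum.
have := enum_uniq 'I_l; have : j \in enum 'I_l by rewrite mem_enum.
case/splitPr=> L L'; rewrite uniq_catC cat_cons /= mem_cat negb_or => /andP[/andP[jL' jL]].
rewrite uniq_catC mem_cat in_cons eq_sym (negPf jk) /= cat_uniq => /and3P[uL disj uL'].
move=> kLL'; rewrite big_cat big_cons /= => rel.
case/orP: kLL' => kr.
- have kL' : k \notin L' by apply: contra disj => kL'; apply/hasP; exists k.
  case/splitPr: kr uL jL rel {disj} => P Q.
  rewrite uniq_catC cat_cons /= mem_cat negb_or => /andP[/andP[kQ kP] _].
  rewrite mem_cat in_cons !negb_or => /and3P[jP _ jQ].
  rewrite big_cat big_cons /=; set a := \prod_(i <- P) s i.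
  set b := \prod_(i <- Q) s i; set c := \prod_(i <- L') s i => rel.
  exists b^-1, (a^-1 * (c * eval_word d W)^-1); split.
  + by apply: multiplierV; apply: mult_seq.
  + by apply: multiplierM; apply: multiplierV; [|apply: multiplierM => //]; apply: mult_seq.
  have /solve : (a * (s k * b)) * s j * (c * eval_word d W) = 1 by rewrite -rel !mulgA.
  by rewrite !invMg !mulgA.
- have kL : k \notin L by apply: contra disj => kL; apply/hasP; exists k.
  case/splitPr: kr uL' jL' rel {disj} => P Q.
  rewrite uniq_catC cat_cons /= mem_cat negb_or => /andP[/andP[kQ kP] _].
  rewrite mem_cat in_cons !negb_or => /and3P[jP _ jQ].
  rewrite big_cat big_cons /=; set a := \prod_(i <- P) s i.
  set b := \prod_(i <- Q) s i; set c := \prod_(i <- L) s i => rel.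
  exists (c^-1 * (b * eval_word d W)^-1), a^-1; split.
  + by apply: multiplierM; apply: multiplierV; [|apply: multiplierM => //]; apply: mult_seq.
  + by apply: multiplierV; apply: mult_seq.
  have /solve : c * s j * (a * (s k * b) * eval_word d W) = 1 by rewrite -rel !mulgA.
  by rewrite !invMg !mulgA.
Qed.
End System.

Section Sufficiency.
Variables (j k : 'I_l) (u v : 'I_l -> int).
Hypotheses (hu : standard_exponents gamma j u) (huj : u j = 1%R) (hvk : v k = 1%R).

Lemma extended_system_entry i :
  eqmod_sign (gamma i) (u i) (v i) ->
  expgz (s i) (v i) = expgz (s i) (u i) \/ expgz (s i) (v i) = (expgz (s i) (u i))^-1.
Proof. by move=> e; apply: (expgz_eqmod_sign (gamma_gt0 i) (expg_gamma i) e). Qed.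

(** For [j] different from [k], exchanging [s k] for [s j] leaves the entries of
    the target up to inversion; they are matched by the transposition of [j] and
    [k], conjugated by the enumerations of the indices that avoid [j] and [k]. *)
Lemma nielsen_equiv_extended :
    (forall i, eqmod_sign (gamma i) (u i) (v i)) ->
  nielsen_equiv (extended_system s d j u) (extended_system s d k v).
Proof.
move=> uv; have pm i := extended_system_entry (uv i).
case: (eqVneq j k) => [<-|jk].
  apply: nielsen_inv_entries => a; rewrite -(splitK a).
  case: (split a) => b /=; rewrite ?tnth_extended_lshift //.
  by left; rewrite !tnth_extended_rshift.
pose f (i : 'I_l.-1) := odflt i (unlift j (tperm j k (lift k i))).
have fK i : lift j (f i) = tperm j k (lift k i).
  rewrite /f; case: unliftP => [i' -> //|] e.
  have : lift k i = k by rewrite -[LHS](tpermK j k) e tpermL.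
  by move/eqP; rewrite eq_sym (negPf (neq_lift k i)).
have f_inj : injective f.
  by move=> a b e; apply: (@lift_inj _ k); apply: (@perm_inj _ (tperm j k)); rewrite -!fK e.
pose g (a : 'I_(l.-1 + q)) : 'I_(l.-1 + q) :=
  unsplit (match split a with inl i => inl (f i) | inr m => inr m end).
have g_inj : injective g.
  move=> a b /(can_inj (@unsplitK _ _)); rewrite -{2}(splitK a) -{2}(splitK b).
  by case: (split a) (split b) => [a'|a'] [b'|b'] // [] => [/f_inj|] ->.
case: (unliftP j k) => [i0 kE|e]; last by rewrite e eqxx in jk.
apply: nielsen_trans (exchange_generator (i0 := i0) hu _) _.
  by rewrite -kE -hvk.
apply: (nielsen_perm_entries (p := perm g_inj)) => a; rewrite permE -(splitK a) /g.
case: (split a) => b; rewrite unsplitK /=; last first.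
  left; rewrite tnth_set_neq ?tnth_extended_rshift //.
  by rewrite -(inj_eq val_inj) /= gtn_eqF // ltn_addr.
rewrite tnth_extended_lshift; case: (eqVneq (lift k b) j) => [e|nj].
  have -> : f b = i0 by apply: (@lift_inj _ j); rewrite fK e tpermL -kE.
  by rewrite tnth_set e; have := pm j; rewrite huj.
have fb : lift j (f b) = lift k b by rewrite fK tpermD ?neq_lift // eq_sym.
rewrite tnth_set_neq.
  by rewrite tnth_extended_lshift fb; apply: pm.
apply: contraTneq (neq_lift k b) => /lshift_inj e.
by rewrite -fb e -kE eqxx.
Qed.

End Sufficiency.

Section Torsion.
Local Open Scope ring_scope.
Local Notation N := (l.-1 + q)%N.
Variables (F : fieldType) (A : 'I_l -> 'M[F]_2).
Hypotheses (detA : forall i, \det (A i) = 1)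
  (sumA : forall i, \sum_(t < gamma i) A i ^+ t = 0)
  (prodA : \prod_(i <- enum 'I_l) A i = 1).

(** The values on the generators other than [s j] can be prescribed: the long
    relator is solved by the choice of the value on [s j], and the Fox
    derivatives of the power relators vanish by [sumA].  Prescribing unit blocks
    makes the stack of the system of exponents 1 the identity matrix. *)
Lemma basis_crossed_hom_exists j :
  exists (rho : G -> 'M[F]_2) (Delta : G -> 'M[F]_(2, N + N)),
    [/\ crossed_hom rho Delta, forall a, \det (rho a) = 1,
        forall i, rho (s i) = A i
      & forall a, Delta (tnth (extended_system s d j (fun=> 1)) a)
                  = (unit_stack F a)^T].
Proof.
pose A' (x : 'I_l + 'I_q) := if x is inl i then A i else 1.
pose B0 (x : 'I_l + 'I_q) : 'M[F]_(2, N + N) :=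
  match x with
  | inl i => if unlift j i is Some i' then (unit_stack F (lshift q i'))^T else 0
  | inr m => (unit_stack F (rshift l.-1 m))^T
  end.
have dA' x : \det (A' x) = 1 by case: x => [i|m] /=; [apply: detA | apply: det1].
have A'u x : A' x \is a GRing.unit.
  by rewrite -[_ \is a _]/(_ \in unitmx) unitmxE dA' unitr1.
pose Ww : word ('I_l + 'I_q) := [seq (inr a.1, a.2) | a <- W].
pose L0 : word ('I_l + 'I_q) := [seq (inl i, false) | i <- enum 'I_l] ++ Ww.
have [B [BE foxL]] : exists B, (forall x, x != inl j -> B x = B0 x) /\ fox A' B L0 = 0.
  rewrite /L0; have := enum_uniq 'I_l; have : j \in enum 'I_l by rewrite mem_enum.
  case/splitPr=> L L'; rewrite uniq_catC cat_cons /= mem_cat negb_or.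
  case/andP=> /andP[jL' jL] _; rewrite map_cat /= -catA cat_cons.
  have [|B BE B0L] := @fox_solve F (N + N) _ A' B0 (inl j)
      [seq (inl i, false) | i <- L] ([seq (inl i, false) | i <- L'] ++ Ww) A'u.
    rewrite !all_cat !all_map; apply/and3P; split; apply/allP=> i //= iL.
      by apply: contraNneq jL => -[<-].
    by apply: contraNneq jL' => -[<-].
  by exists B.
have rel r : fuchsian_relator gamma W r -> word_mx A' r = 1 /\ fox A' B r = 0.
  case=> [i|]; split=> //.
  - rewrite /word_mx big_nseq /letter_mx /=.
    have -> : iter (gamma i) ( *%R (A i)) 1 = A i ^+ gamma i.
      by elim: (gamma i) => [|n IH]; rewrite ?expr0 // exprS -IH.
    by apply/eqP; rewrite -subr_eq0 subrX1 sumA mulr0.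
  - by rewrite fox_nseq /= sumA mul0mx.
  - have <- : \prod_(i <- enum 'I_l) A i * \prod_(a <- W) 1 = 1 :> 'M[F]_2.
      by rewrite prodA big1 ?mulr1.
    rewrite word_mx_cat /word_mx !big_map; congr (_ * _).
    by apply: eq_bigr => -[m []] _; rewrite /letter_mx /= ?invr1.
have [rho [Delta [hD dr rhoE DE]]] := crossed_hom_exists hG dA' rel.
exists rho, Delta; split=> // [i|a]; first exact: (rhoE (inl i)).
rewrite -(splitK a); case: (split a) => b /=.
  rewrite tnth_extended_lshift /expgz /= expg1 (DE (inl _)) BE /= ?liftK //.
  by apply: contraNneq (neq_lift j b) => -[->].
by rewrite tnth_extended_rshift (DE (inr _)) BE.
Qed.

(** The index [j] is missing from the system, but as [u j = 1] its factor in the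
    product over all indices is 1. *)
Lemma det_stack_extended (rho : G -> 'M[F]_2) (Delta : G -> 'M[F]_(2, N + N)) j u :
    crossed_hom rho Delta -> (forall i, rho (s i) = A i) -> u j = 1 ->
  \det (stack (Delta \o tnth (extended_system s d j u))) =
    (\prod_i \det (\sum_(t < nat_residue (gamma i) (u i)) A i ^+ t)) *
    \det (stack (Delta \o tnth (extended_system s d j (fun=> 1)))).
Proof.
move=> hD rhoE uj.
pose C (a : 'I_N) : 'M[F]_2 := if split a is inl i then
  \sum_(t < nat_residue (gamma (lift j i)) (u (lift j i))) A (lift j i) ^+ t else 1.
rewrite (det_stack_mull (C := C) (f := Delta \o tnth (extended_system s d j (fun=> 1)))).
  rewrite big_split_ord /= (bigD1_ord j) //=; congr (_ * _).
  rewrite uj /nat_residue modz_small /=; last by rewrite ltz_nat gamma_ge2.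
  rewrite big_ord_recl big_ord0 addr0 expr0 det1 mul1r [X in _ * X]big1 ?mulr1.
    by apply: eq_bigr => i _; rewrite /C (unsplitK (inl i)).
  by move=> m _; rewrite /C (unsplitK (inr m)) det1.
move=> a; rewrite /= /C -{1 3}(splitK a); case: (split a) => b /=.
  rewrite !tnth_extended_lshift (expgz_residue (gamma_gt0 _) (expg_gamma _)).
  by rewrite (crossed_homX hD) rhoE.
by rewrite !tnth_extended_rshift mul1mx.
Qed.

(** The systems of exponents 1 for [j] and for [k] are Nielsen equivalent, hence
    have stacks of the same determinant, and only the geometric sums remain. *)
Lemma nielsen_equiv_torsion j k u v : u j = 1 -> v k = 1 ->
    nielsen_equiv (extended_system s d j u) (extended_system s d k v) ->
  \prod_i \det (\sum_(t < nat_residue (gamma i) (u i)) A i ^+ t) =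
  \prod_i \det (\sum_(t < nat_residue (gamma i) (v i)) A i ^+ t).
Proof.
move=> uj vk UV.
have [rho [Delta [hD dr rhoE DE]]] := basis_crossed_hom_exists j.
have d1 : \det (stack (Delta \o tnth (extended_system s d j (fun=> 1)))) = 1.
  by rewrite (eq_stack DE) stack_unit_stackT det1.
have d2 : \det (stack (Delta \o tnth (extended_system s d k (fun=> 1)))) = 1.
  rewrite -d1; apply: esym; apply: nielsen_det_stack hD dr _.
  by apply: nielsen_equiv_extended => // i; [rewrite /coprimez gcd1z | left].
have := nielsen_det_stack hD dr UV.
by rewrite (det_stack_extended hD rhoE uj) (det_stack_extended hD rhoE vk) d1 d2 !mulr1.
Qed.

End Torsion.

End FuchsianGroup.

(** * Nielsen equivalence of the extended systems *)

Lemma three_large_exponents l (gamma : 'I_l -> nat) : ~ exceptional gamma ->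
  exists i1 i2 i3 : 'I_l, [/\ i1 != i2, i1 != i3, i2 != i3
    & forall i, i \in [:: i1; i2; i3] -> 2 < gamma i].
Proof.
move=> exc; have : 3 < size (big_exponents gamma).
  by rewrite ltnNge; apply/negP=> le3; apply: exc; apply: ExcA.
rewrite size_sort size_map.
have := filter_uniq (fun i => 3 <= gamma i) (enum_uniq 'I_l).
have := filter_all (fun i => 3 <= gamma i) (enum 'I_l).
case: [seq _ <- _ | _] => [|i1 [|i2 [|i3 r]]] //= /and4P[g1 g2 g3 _].
rewrite !in_cons !negb_or => /and3P[/and3P[n12 n13 _] /andP[n23 _] _] _.
exists i1, i2, i3; split=> // i; rewrite !inE.
by case/or3P => /eqP ->.
Qed.

Lemma eqmod_sign_residue n (a b : int) : 0 < n ->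
    nat_residue n a = nat_residue n b %[mod n] \/
    (n %| nat_residue n a + nat_residue n b)%N ->
  eqmod_sign n a b.
Proof.
move=> n0 [e|dv]; [left|right].
  by rewrite -(modz_mod a) -(nat_residueE n0 a) modz_nat e -modz_nat nat_residueE // modz_mod.
apply/eqP; rewrite eqz_mod_dvd opprK; apply/dvdz_mod0P.
by rewrite -modzDm -(nat_residueE n0 a) -(nat_residueE n0 b) -PoszD modz_nat (eqP dv).
Qed.

Theorem theorem8p2 (l q : nat) (gamma : 'I_l -> nat) (W : word 'I_q)
    (G : groupType) (s : 'I_l -> G) (d : 'I_q -> G)
    (hl : 3 <= l) (hgamma : forall i : 'I_l, 2 <= gamma i)
    (hG : has_presentation (fuchsian_generators s d)
            (fuchsian_relator gamma W))
    (hG0 : ~ exceptional gamma)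
    (j k : 'I_l) (u v : 'I_l -> int)
    (hU : standard_exponents gamma j u) (hV : standard_exponents gamma k v)
    (huj : u j = 1%R) (hvk : v k = 1%R) :
  nielsen_equiv (extended_system s d j u) (extended_system s d k v) <->
  (forall i : 'I_l, eqmod_sign (gamma i) (u i) (v i)).
Proof.
split=> [UV i0|]; last exact: (nielsen_equiv_extended hgamma hG hU huj hvk).
have gam0 i : 0 < gamma i by apply: ltnW.
have res_coprime m w i : standard_exponents gamma m w -> w m = 1%R ->
    coprime (nat_residue (gamma i) (w i)) (gamma i).
  move=> hw wm; apply: (coprime_residue (gam0 i)).
  by case: (eqVneq i m) => [->|/hw //]; rewrite wm /coprimez gcd1z.
have cu i := res_coprime j u i hU huj; have cv i := res_coprime k v i hV hvk.
pose z i : algC := sval (C_prim_root_exists (gam0 i)).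
have prim i : ((gamma i).-primitive_root (z i))%R.
  by rewrite /z; case: (C_prim_root_exists _).
have [i1 [i2 [i3 [n12 n13 n23 big123]]]] := three_large_exponents hG0.
(* Up to a common factor, the torsion of the system with exponents w at the
   primitive roots z i ^+ p i. *)
pose prod_chord (w : 'I_l -> int) (p : 'I_l -> nat) :=
  (\prod_i chord_sq (z i) (p i * nat_residue (gamma i) (w i))%N)%R.
have chordE p : (forall i, coprime (p i) (gamma i)) -> prod_chord u p = prod_chord v p.
  move=> cp.
  have prim_p i : ((gamma i).-primitive_root (z i ^+ p i))%R.
    by rewrite (prim_root_exp_coprime _ (prim i)).
  have [A [detA sumA torsA prodA]] := root_matrices_exist (enum_uniq 'I_l)
    hgamma prim_p (mem_enum _ i1) (mem_enum _ i2) (mem_enum _ i3) n12 n13 n23 big123.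
  have E w : prod_chord w p =
      ((\prod_i \det (\sum_(t < nat_residue (gamma i) (w i)) A i ^+ t)) *
       \prod_i chord_sq (z i ^+ p i) 1)%R.
    by rewrite -big_split; apply: eq_bigr => i _; rewrite /= torsA /chord_sq -!exprM.
  by rewrite !E (nielsen_equiv_torsion hgamma hG detA sumA prodA huj hvk UV).
apply: (eqmod_sign_residue (gam0 i0)); apply: (chord_sq_inj (prim i0)).
(* Only the root at i0 varies from here on; K collects the other factors. *)
pose K (w : 'I_l -> int) :=
  (\prod_(i | i != i0) chord_sq (z i) (nat_residue (gamma i) (w i)))%R.
have chord_gt0 i a : coprime a (gamma i) -> (0 < chord_sq (z i) a)%R.
  exact: chord_sq_gt0 (prim i) _ (hgamma i).
have K_gt0 w : (forall i, coprime (nat_residue (gamma i) (w i)) (gamma i)) -> (0 < K w)%R.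
  by move=> cw; apply: prodr_gt0 => i _; apply: chord_gt0.
apply: (eq_of_proportional (gam0 i0) (cu i0) (cv i0) (chord_sq_mod (prim i0)) _
  (K_gt0 u cu) (K_gt0 v cv)) => [|p cp].
  by rewrite gt_eqF ?chord_gt0 ?coprime1n.
have := chordE (fun i => if i == i0 then p else 1%N) _.
have E w : prod_chord w (fun i => if i == i0 then p else 1%N) =
    (chord_sq (z i0) (p * nat_residue (gamma i0) (w i0)) * K w)%R.
  rewrite /prod_chord (bigD1 i0) //= eqxx; congr (_ * _)%R.
  by apply: eq_bigr => i /negPf ->; rewrite mul1n.
by rewrite !E; apply=> i; case: eqP => [->|]; rewrite ?coprime1n.
Qed.
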